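(* Let $X\in\mathbb{R}^{n\times d}$, $n>d$, have rank $d$, and let $\alpha\in(0,1)$ and $\varepsilon\in(0,1)$. Let $\hat\ell_1(X),\dots,\hat\ell_n(X)$ be (random) approximate leverage scores such that, with high probability, simultaneously for all $i=1,\dots,n$, $$(1-\alpha)\,\ell_i(X)\le\hat\ell_i(X)\le(1+\alpha)\,\ell_i(X).$$ Order the rows of $X$ so that $\hat\ell_1(X)\ge\dots\ge\hat\ell_n(X)$, put $t=\sum_{i=1}^n\hat\ell_i(X)$, let $s$ be the smallest $j\in\{1,\dots,n\}$ such that $\sum_{i=1}^j\hat\ell_i(X)>t-(1-\alpha)\varepsilon$, and let $X_s\in\mathbb{R}^{s\times d}$ consist of the first $s$ rows of $X$ in this order. Then, with high probability (namely, with at least the probability with which the simultaneous approximation above holds), $$(1-\varepsilon)X^\top X\prec X_s^\top X_s\preceq X^\top X.$$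
   Context: For $X\in\mathbb{R}^{n\times d}$ of rank $d$, the $i$th leverage score is $\ell_i(X)=e_i^\top X(X^\top X)^{-1}X^\top e_i$, where $e_i$ is the $i$th standard basis vector. For symmetric matrices, $A\preceq B$ means that $B-A$ is positive semidefinite and $A\prec B$ means that $B-A$ is positive definite. *)

(* Defs.v *)
From HB Require Import structures.
From mathcomp Require Import all_boot all_order all_algebra perm.
From mathcomp Require Import all_classical all_reals all_analysis.
Set Implicit Arguments. Unset Strict Implicit. Unset Printing Implicit Defensive.
Import Order.TTheory GRing.Theory Num.Theory.
Local Open Scope ring_scope.

Definition possemidefmx (R : realType) (d : nat) (A : 'M[R]_d) : Prop :=
  A^T = A /\ forall v : 'cV[R]_d, 0 <= (v^T *m A *m v) 0 0.

Definition posdefmx (R : realType) (d : nat) (A : 'M[R]_d) : Prop :=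
  A^T = A /\ forall v : 'cV[R]_d, v != 0 -> 0 < (v^T *m A *m v) 0 0.

Definition loewner_le (R : realType) (d : nat) (A B : 'M[R]_d) : Prop :=
  possemidefmx (B - A).

Definition loewner_lt (R : realType) (d : nat) (A B : 'M[R]_d) : Prop :=
  posdefmx (B - A).

(* [invmx] is the inverse only on invertible matrices; here [X^T *m X] is
   invertible exactly when [\rank X = d]. *)
Definition leverage (R : realType) (n d : nat) (X : 'M[R]_(n, d)) (i : 'I_n) : R :=
  let e : 'cV[R]_n := delta_mx i 0 in
  (e^T *m X *m invmx (X^T *m X) *m X^T *m e) 0 0.

(* [p i] is the index of the row placed at position [i] (from 0); ties may be
   broken in any way. *)
Definition nonincreasing_order (R : realType) (n : nat) (l : 'I_n -> R)
    (p : 'S_n) : Prop :=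
  forall i j : 'I_n, (i <= j)%N -> l (p j) <= l (p i).

Definition top_sum (R : realType) (n : nat) (l : 'I_n -> R) (p : 'S_n)
    (j : nat) : R :=
  \sum_(i < n | (i < j)%N) l (p i).

Definition exceeds_cutoff (R : realType) (n : nat) (c : R) (l : 'I_n -> R)
    (p : 'S_n) (j : nat) : Prop :=
  \sum_(i < n) l i - c < top_sum l p j.

Definition is_sample_size (R : realType) (n : nat) (c : R) (l : 'I_n -> R)
    (p : 'S_n) (s : 'I_n.+1) : Prop :=
  [/\ (1 <= s)%N, exceeds_cutoff c l p s &
      forall j : nat, (1 <= j <= n)%N -> exceeds_cutoff c l p j -> (s <= j)%N].

Definition top_rows (R : realType) (n d : nat) (X : 'M[R]_(n, d)) (p : 'S_n)
    (s : 'I_n.+1) : 'M[R]_(s, d) :=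
  rowsub (fun i : 'I_s => p (widen_ord (leq_ord s) i)) X.

Definition good_approx (R : realType) (n d : nat) (X : 'M[R]_(n, d)) (alpha : R)
    (l : 'I_n -> R) : Prop :=
  forall i : 'I_n,
    (1 - alpha) * leverage X i <= l i /\ l i <= (1 + alpha) * leverage X i.

(* The sandwich holds for every admissible ordering, hence for any, possibly
   random, tie-breaking rule. *)
Definition good_sketch (R : realType) (n d : nat) (X : 'M[R]_(n, d))
    (alpha eps : R) (l : 'I_n -> R) : Prop :=
  forall (p : 'S_n) (s : 'I_n.+1),
    nonincreasing_order l p ->
    is_sample_size ((1 - alpha) * eps) l p s ->
    let Xs := top_rows X p s in
    loewner_lt ((1 - eps) *: (X^T *m X)) (Xs^T *m Xs) /\
    loewner_le (Xs^T *m Xs) (X^T *m X).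

(* The next two lemmas show that the quantifiers over [p] and [s] in
   [good_sketch] are never vacuous. *)
Lemma nonincreasing_order_exists (R : realType) (n : nat) (l : 'I_n -> R) :
  exists p : 'S_n, nonincreasing_order l p.
Proof.
pose r := [rel x y : 'I_n | l y <= l x].
have rtot : total r by move=> x y; exact: le_total.
have rtr : transitive r by move=> y x z /= xy yz; exact: le_trans yz xy.
have sz : size (sort r (enum 'I_n)) == n by rewrite size_sort size_enum_ord.
have tn : forall i, tnth (Tuple sz) i = nth i (sort r (enum 'I_n)) i.
  by move=> i; rewrite (tnth_nth i).
have inj : injective (tnth (Tuple sz)).
  by apply/tuple_uniqP; rewrite /= sort_uniq enum_uniq.
exists (perm inj) => i j ij; rewrite !permE !(tnth_nth i) /=.
apply: (sorted_leq_nth rtr _ i (sort_sorted rtot _)) => //.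
- by move=> x /=.
- by rewrite inE size_sort size_enum_ord.
- by rewrite inE size_sort size_enum_ord.
Qed.

Lemma is_sample_size_exists (R : realType) (n : nat) (c : R) (l : 'I_n -> R)
    (p : 'S_n) :
  (0 < n)%N -> 0 < c -> exists s : 'I_n.+1, is_sample_size c l p s.
Proof.
move=> n0 c0.
pose Q j := (1 <= j <= n)%N && (\sum_(i < n) l i - c < top_sum l p j).
have exQ : exists j, Q j.
  exists n; rewrite /Q n0 leqnn /=.
  have -> : top_sum l p n = \sum_(i < n) l i.
    rewrite /top_sum (eq_bigl xpredT) => [|i]; last by rewrite ltn_ord.
    by rewrite [RHS](reindex_inj (@perm_inj _ p)).
  by rewrite ltrBlDr ltrDl.
case: (ex_minnP exQ) => s /andP[/andP[s1 sn] sc] smin.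
exists (Ordinal (sn : (s < n.+1)%N)); split => // j jn jc.
by apply: smin; rewrite /Q jn.
Qed.

(* Main.v *)
Require Import Defs.
From HB Require Import structures.
From mathcomp Require Import all_boot all_order all_algebra perm.
From mathcomp Require Import all_classical all_reals all_analysis.
From mathcomp Require Import measurable_realfun ring lra.
Set Implicit Arguments. Unset Strict Implicit. Unset Printing Implicit Defensive.
Import Order.TTheory GRing.Theory Num.Theory.
Local Open Scope classical_set_scope.
Local Open Scope ring_scope.

(** If [G = X^T X] and [x_i] is the [i]th row of [X], Cauchy-Schwarz gives
    [(x_i v)^2 <= l_i (v^T G v)], where [l_i] is the leverage score.  On the
    good event, [v^T (X^T X - Xs^T Xs) v] is the sum of the [(x_i v)^2] over the
    omitted rows.  It is nonnegative and at most [v^T G v] times the sum of the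
    omitted leverage scores, which is at most [(1 - alpha)^-1] times the sum of
    the omitted approximate scores, hence less than [eps]. *)

(** * The Gram form and its Cauchy-Schwarz bound by leverage scores *)

Section Gram.
Variables (R : realType) (n d : nat).
Implicit Types (X : 'M[R]_(n, d)) (v : 'cV[R]_d).

Lemma quad_gram X v :
  (v^T *m (X^T *m X) *m v) 0 0 = \sum_i (X *m v) i 0 ^+ 2.
Proof.
rewrite mulmxA -mulmxA -trmx_mul mxE.
by apply: eq_bigr => i _; rewrite mxE expr2.
Qed.

(** The form is a sum of squares of the entries of [X *m v], and full column rank makes [X]
    injective on columns. *)
Lemma quad_gram_eq0 X v :
  \rank X = d -> ((v^T *m (X^T *m X) *m v) 0 0 == 0) = (v == 0).
Proof.
move=> rX; apply/idP/eqP => [|->]; last by rewrite mulmx0 mxE.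
rewrite quad_gram psumr_eq0 => [/allP Xv0|i _]; last exact: sqr_ge0.
have Xv : X *m v = 0.
  apply/colP => i; have := Xv0 i; rewrite mem_index_enum sqrf_eq0 => /(_ isT).
  by move/eqP => ->; rewrite mxE.
(* [mulmx_free_eq0] cancels a row-free factor on the right, so the equation is transposed to bring
   in [X^T]. *)
apply/trmx_inj/eqP; rewrite trmx0 -(mulmx_free_eq0 _ (B := X^T)).
  by rewrite -trmx_mul Xv trmx0.
by rewrite /row_free mxrank_tr rX.
Qed.

Lemma quad_gram_gt0 X v :
  \rank X = d -> v != 0 -> 0 < (v^T *m (X^T *m X) *m v) 0 0.
Proof.
move=> rX v0; rewrite lt_neqAle eq_sym quad_gram_eq0 // v0 quad_gram.
by apply: sumr_ge0 => i _; exact: sqr_ge0.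
Qed.

(** A row [v] in the left kernel makes the form vanish at [v^T], so definiteness forces it to be
    zero. *)
Lemma gram_unitmx X : \rank X = d -> X^T *m X \in unitmx.
Proof.
move=> rX; rewrite -row_free_unit -kermx_eq0.
apply/rowV0P => v /sub_kermxP vG.
apply/trmx_inj/eqP; rewrite trmx0 -(quad_gram_eq0 _ rX) trmxK vG.
by rewrite mul0mx mxE.
Qed.

Lemma sqr_entry_le_leverage X v i : \rank X = d ->
  (X *m v) i 0 ^+ 2 <= leverage X i * (v^T *m (X^T *m X) *m v) 0 0.
Proof.
move=> rX; have GU := gram_unitmx rX.
have [->|v0] := eqVneq v 0.
  by rewrite !mulmx0 !mxE expr0n mulr0.
have g0 := quad_gram_gt0 rX v0.
set g := (_ 0 0) in g0 *; set a := (X *m v) i 0.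
pose e : 'cV[R]_n := delta_mx i 0.
(* [y] represents the functional [v |-> (X *m v) i 0] in the inner product given by [X^T *m X]; its
   squared norm there is the leverage score. *)
pose y := invmx (X^T *m X) *m X^T *m e.
have Gy : (X^T *m X) *m y = X^T *m e by rewrite /y !mulmxA (mulmxV GU) mul1mx.
have Gyt : y^T *m (X^T *m X) = e^T *m X.
  by apply: trmx_inj; rewrite trmx_mul trmxK trmx_mul trmxK Gy trmx_mul trmxK.
have yl : (y^T *m (X^T *m X) *m y) 0 0 = leverage X i.
  by rewrite Gyt /leverage /y !mulmxA.
have ya : (y^T *m (X^T *m X) *m v) 0 0 = a.
  by rewrite Gyt -mulmxA trmx_delta -rowE mxE.
have ay : (v^T *m (X^T *m X) *m y) 0 0 = a.
  by rewrite -mulmxA Gy mulmxA -trmx_mul -colE 2!mxE.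
(* Expands [|X (g y - a v)|^2 >= 0]. *)
have : 0 <= ((g *: y - a *: v)^T *m (X^T *m X) *m (g *: y - a *: v)) 0 0.
  by rewrite quad_gram; apply: sumr_ge0 => j _; exact: sqr_ge0.
have -> : (g *: y - a *: v)^T = g *: y^T - a *: v^T.
  by rewrite linearB !linearZ.
rewrite !mulmxBl !mulmxBr -!scalemxAl -!scalemxAr.
have mxB (A B : 'M[R]_1) : (A - B) 0 0 = A 0 0 - B 0 0 by rewrite !mxE.
have mxZ c (A : 'M[R]_1) : (c *: A) 0 0 = c * A 0 0 by rewrite mxE.
rewrite !(mxB, mxZ) yl ya ay -/g.
(* The expansion is [g] times the desired gap. Cancelling [g] requires [g > 0], hence the separate
   case [v = 0]. *)
have -> : forall l,
    g * (g * l) - g * (a * a) - (a * (g * a) - a * (a * g)) =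
    g * (l * g - a ^+ 2) by move=> l; ring.
by rewrite pmulr_rge0 // subr_ge0.
Qed.

End Gram.

(** * Retained and omitted rows *)

Section TopRows.
Variables (R : realType) (n : nat).
Implicit Types (p : 'S_n) (f : 'I_n -> R).

Lemma sum_split_top f p (s : nat) :
  \sum_i f i = top_sum f p s + \sum_(i < n | ~~ (i < s)%N) f (p i).
Proof.
rewrite (reindex_inj (@perm_inj _ p)) /=.
by rewrite (bigID (fun i : 'I_n => (i < s)%N)).
Qed.

Lemma quad_gram_top_rows d (X : 'M[R]_(n, d)) p (s : 'I_n.+1) (v : 'cV_d) :
  (v^T *m ((top_rows X p s)^T *m top_rows X p s) *m v) 0 0 =
  top_sum (fun i => (X *m v) i 0 ^+ 2) p s.
Proof.
rewrite quad_gram /top_sum (big_ord_narrow (leq_ord s)) /=.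
by apply: eq_bigr => i _; rewrite mul_rowsub_mx mxE.
Qed.

(** Both Loewner bounds are read off from this identity: the gap between the two forms is exactly
    the omitted sum of squares. *)
Lemma quad_gram_omitted d (X : 'M[R]_(n, d)) p (s : 'I_n.+1) (v : 'cV_d) :
  (v^T *m (X^T *m X) *m v) 0 0 =
  (v^T *m ((top_rows X p s)^T *m top_rows X p s) *m v) 0 0 +
  \sum_(i < n | ~~ (i < s)%N) (X *m v) (p i) 0 ^+ 2.
Proof. by rewrite quad_gram_top_rows quad_gram (sum_split_top _ p s). Qed.

End TopRows.

(** * The deterministic sandwich *)

Lemma quad_mxB (R : realType) (d : nat) (A B : 'M[R]_d) (v : 'cV[R]_d) :
  (v^T *m (A - B) *m v) 0 0 = (v^T *m A *m v) 0 0 - (v^T *m B *m v) 0 0.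
Proof. by rewrite mulmxBr mulmxBl !mxE. Qed.

Lemma quad_mxZ (R : realType) (d : nat) (c : R) (A : 'M[R]_d) (v : 'cV[R]_d) :
  (v^T *m (c *: A) *m v) 0 0 = c * (v^T *m A *m v) 0 0.
Proof. by rewrite -scalemxAr -scalemxAl mxE. Qed.

Lemma good_approx_sketch (R : realType) (n d : nat) (X : 'M[R]_(n, d))
    (alpha eps : R) (l : 'I_n -> R) : \rank X = d -> alpha < 1 ->
  good_approx X alpha l -> good_sketch X alpha eps l.
Proof.
move=> rX a1 approx p s _ [_ cut _] Xs.
have a0 : 0 < 1 - alpha by rewrite subr_gt0.
have gram_sym m (A : 'M[R]_(m, d)) : (A^T *m A)^T = A^T *m A.
  by rewrite trmx_mul trmxK.
(* The factor [1 - alpha] in the cutoff offsets the one lost in passing from leverage scores to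
   approximate scores. *)
have omitted : \sum_(i < n | ~~ (i < s)%N) leverage X (p i) < eps.
  rewrite -(ltr_pM2l a0) mulr_sumr.
  apply: (@le_lt_trans _ _ (\sum_(i < n | ~~ (i < s)%N) l (p i))).
    by apply: ler_sum => i _; case: (approx (p i)).
  by move: cut; rewrite /exceeds_cutoff (sum_split_top l p s); lra.
split; split.
- by rewrite linearB linearZ /= !gram_sym.
- move=> v v0; have g0 := quad_gram_gt0 rX v0.
  have := quad_gram_omitted X p s v.
  have : \sum_(i < n | ~~ (i < s)%N) (X *m v) (p i) 0 ^+ 2 <
      eps * (v^T *m (X^T *m X) *m v) 0 0.
    apply: (@le_lt_trans _ _ (\sum_(i < n | ~~ (i < s)%N)
        leverage X (p i) * (v^T *m (X^T *m X) *m v) 0 0)).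
      by apply: ler_sum => i _; exact: sqr_entry_le_leverage.
    (* The strict bound [omitted] stays strict because the form is positive at [v != 0]. *)
    by rewrite -mulr_suml ltr_pM2r.
  by rewrite quad_mxB quad_mxZ -/Xs => + E; rewrite E; lra.
- by rewrite linearB /= !gram_sym.
- move=> v; rewrite quad_mxB (quad_gram_omitted X p s v).
  rewrite addrAC subrr add0r; apply: sumr_ge0 => i _; exact: sqr_ge0.
Qed.

(** * Measurability of the two events *)

Section Measurability.
Variables (R : realType) (disp : measure_display) (T : measurableType disp).

Lemma measurable_forall_fin (I : finType) (Q : I -> set T) :
  (forall i, measurable (Q i)) -> measurable [set w | forall i, Q i w].
Proof.
move=> mQ; rewrite (_ : mkset _ = \bigcap_i Q i).
  by apply: fin_bigcap_measurable => [|i _]; [exact: finite_finset|exact: mQ].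
by apply/seteqP; split => w Qw i *; exact: Qw.
Qed.

Lemma measurable_imply (A B : set T) :
  measurable A -> measurable B -> measurable [set w | A w -> B w].
Proof.
move=> mA mB; rewrite (_ : mkset _ = ~` A `|` B).
  by apply: measurableU => //; exact: measurableC.
by apply/funext => w; exact: implyE.
Qed.

Lemma measurable_const (Q : Prop) : measurable [set _ : T | Q].
Proof.
have [q|q] := pselect Q.
  by rewrite (_ : mkset _ = setT) //; apply/seteqP; split.
by rewrite (_ : mkset _ = set0) //; apply/seteqP; split.
Qed.

Lemma measurable_le (f g : T -> R) :
  measurable_fun setT f -> measurable_fun setT g ->
  measurable [set w | f w <= g w].
Proof.
by move=> mf mg; rewrite -[mkset _]setTI; exact: measurable_fun_le.
Qed.

Lemma measurable_lt (f g : T -> R) :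
  measurable_fun setT f -> measurable_fun setT g ->
  measurable [set w | f w < g w].
Proof.
move=> mf mg; rewrite (_ : mkset _ = ~` [set w | g w <= f w]).
  exact/measurableC/measurable_le.
by apply/seteqP; split => w /=; rewrite ltNge => /negP.
Qed.

Variables (n : nat) (l : 'I_n -> T -> R).
Hypothesis ml : forall i, measurable_fun setT (l i).

Lemma measurable_good_approx d (X : 'M[R]_(n, d)) alpha :
  measurable [set w | good_approx X alpha (fun i => l i w)].
Proof.
apply: measurable_forall_fin => i.
apply: measurableI; exact: measurable_le.
Qed.

Lemma measurable_nonincreasing_order p :
  measurable [set w | nonincreasing_order (fun i => l i w) p].
Proof.
do 2 apply: measurable_forall_fin => ?.
apply: measurable_imply; first exact: measurable_const.
exact: measurable_le.
Qed.

Lemma measurable_exceeds_cutoff c p j :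
  measurable [set w | exceeds_cutoff c (fun i => l i w) p j].
Proof.
apply: measurable_lt.
  by apply: measurable_funB => //; exact: measurable_sum.
(* The filter moves the condition into the index sequence, the form that [measurable_sum]
   handles. *)
rewrite /top_sum; under eq_fun do rewrite -big_filter.
exact: measurable_sum.
Qed.

Lemma measurable_is_sample_size c p s :
  measurable [set w | is_sample_size c (fun i => l i w) p s].
Proof.
rewrite (_ : mkset _ = [set _ | (1 <= s)%N] `&`
  [set w | exceeds_cutoff c (fun i => l i w) p s] `&`
  \bigcap_j [set w | (1 <= j <= n)%N ->
    exceeds_cutoff c (fun i => l i w) p j -> (s <= j)%N]).
  apply: measurableI.
    apply: measurableI; first exact: measurable_const.
    exact: measurable_exceeds_cutoff.
  (* Here [j] ranges over all of [nat], so the intersection is countable rather than finite. *)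
  apply: bigcapT_measurable => j.
  apply: measurable_imply; first exact: measurable_const.
  apply: measurable_imply; last exact: measurable_const.
  exact: measurable_exceeds_cutoff.
apply/seteqP; split => w /=.
  by move=> [s1 cs smin]; do !split => //; move=> j _; exact: smin.
by move=> [[s1 cs] smin]; split => // j; exact: smin.
Qed.

Lemma measurable_good_sketch d (X : 'M[R]_(n, d)) alpha eps :
  measurable [set w | good_sketch X alpha eps (fun i => l i w)].
Proof.
apply: measurable_forall_fin => p; apply: measurable_forall_fin => s.
apply: measurable_imply; first exact: measurable_nonincreasing_order.
apply: measurable_imply; first exact: measurable_is_sample_size.
(* Once [p] and [s] are fixed, the matrix inequalities no longer depend on the outcome. *)
exact: measurable_const.
Qed.

End Measurability.

Theorem corollaryB2 (R : realType) (disp : measure_display)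
    (T : measurableType disp) (P : probability T R)
    (n d : nat) (X : 'M[R]_(n, d)) (alpha eps : R)
    (lhat : 'I_n -> {RV P >-> R})
    (hnd : (d < n)%N) (hrank : \rank X = d)
    (halpha : 0 < alpha < 1) (heps : 0 < eps < 1) :
  let approx := [set w : T | good_approx X alpha (fun i => lhat i w)] in
  let sketch := [set w : T | good_sketch X alpha eps (fun i => lhat i w)] in
  measurable sketch /\ (P approx <= P sketch)%E.
Proof.
have ml i : measurable_fun setT (lhat i : T -> R) by exact: measurable_funPT.
move=> approx sketch.
have msketch : measurable sketch by exact: measurable_good_sketch.
(* The sandwich follows from the approximation outcome by outcome, so monotonicity of [P] on
   measurable events concludes. *)
split=> //; apply: le_measure; rewrite ?inE //.
  exact: measurable_good_approx.
by move=> w; apply: good_approx_sketch => //; case/andP: halpha.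
Qed.
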